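(* Let $\{\alpha,S_0,\vartheta_1,\vartheta_2\}$ be an admissible quadruple such that $0,\mathrm{i}\notin\sigma(\alpha)$. Then the sequence $\{C_k\}$ generated by this quadruple tends to $j$ when $k$ tends to infinity.
   Context: $\sigma(\alpha)$ is the spectrum of $\alpha$; $X>0$ means that $X$ is Hermitian with all eigenvalues positive. Let $m_1,m_2\in\mathbb{N}$, $j=\mathrm{diag}\{I_{m_1},-I_{m_2}\}$. A quadruple $\{\alpha,S_0,\vartheta_1,\vartheta_2\}$ of complex $n\times n$ matrices $\alpha,S_0$ and $n\times m_k$ matrices $\vartheta_k$ ($k=1,2$) is admissible if $S_0>0$ and $$\alpha S_0-S_0\alpha^*=\mathrm{i}(\vartheta_1\vartheta_1^*+\vartheta_2\vartheta_2^* ).$$ The sequence generated by the quadruple is $$C_k=j+\Lambda_k^*S_k^{-1}\Lambda_k-\Lambda_{k+1}^*S_{k+1}^{-1}\Lambda_{k+1}\quad(k=0,1,2,\dots),$$ $$\Lambda_0=\begin{bmatrix}\vartheta_1&\vartheta_2\end{bmatrix},\quad \Lambda_{k+1}=\Lambda_k+\mathrm{i}\alpha^{-1}\Lambda_kj,\quad S_{k+1}=S_k+\alpha^{-1}S_k(\alpha^* )^{-1}+\alpha^{-1}\Lambda_kj\Lambda_k^*(\alpha^* )^{-1}.$$ (Under the stated assumptions all $S_k>0$, so the sequence is well defined.) *)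

(* Defs.v *)
From HB Require Import structures.
From mathcomp Require Import all_boot all_order all_algebra.
From mathcomp Require Import all_classical all_reals all_analysis.
From mathcomp Require Import complex.

Set Implicit Arguments.
Unset Strict Implicit.
Unset Printing Implicit Defensive.

Import Order.TTheory GRing.Theory Num.Theory.
Import numFieldNormedType.Exports.

Local Open Scope ring_scope.
Local Open Scope complex_scope.
Local Open Scope sesquilinear_scope.

(* [R[i]] is not in the scope of the generic instances of
   [numFieldNormedType.Exports]: give it the topology of its modulus. *)
HB.instance Definition _ (R : realType) := NormedModule.copy R[i] R[i]^o.

Section Definitions.
Variable R : realType.
Local Notation C := R[i].

(* In the partial order of [C], [0 < a] entails that [a] is real. *)
Definition posdef_mx n (X : 'M[C]_n) : Prop :=
  X \is hermsymmx /\ forall a : C, eigenvalue X a -> 0 < a.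

Definition signature_mx m1 m2 : 'M[C]_(m1 + m2) :=
  block_mx 1%:M 0 0 (- 1%:M).

Section Quadruple.
Variables (n m1 m2 : nat) (alpha S0 : 'M[C]_n).
Variables (theta1 : 'M[C]_(n, m1)) (theta2 : 'M[C]_(n, m2)).
Local Notation j := (signature_mx m1 m2).

Definition admissible : Prop :=
  posdef_mx S0 /\
  alpha *m S0 - S0 *m alpha ^t* =
    'i *: (theta1 *m theta1 ^t* + theta2 *m theta2 ^t*).

Fixpoint Lambda_seq (k : nat) : 'M[C]_(n, m1 + m2) :=
  if k is k'.+1 then
    Lambda_seq k' + 'i *: (invmx alpha *m Lambda_seq k' *m j)
  else row_mx theta1 theta2.

Fixpoint S_seq (k : nat) : 'M[C]_n :=
  if k is k'.+1 then
    S_seq k' + invmx alpha *m S_seq k' *m invmx (alpha ^t*)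
    + invmx alpha *m Lambda_seq k' *m j *m (Lambda_seq k') ^t*
        *m invmx (alpha ^t*)
  else S0.

Definition C_seq (k : nat) : 'M[C]_(m1 + m2) :=
  j + (Lambda_seq k) ^t* *m invmx (S_seq k) *m Lambda_seq k
    - (Lambda_seq k.+1) ^t* *m invmx (S_seq k.+1) *m Lambda_seq k.+1.

End Quadruple.
End Definitions.

Arguments signature_mx : clear implicits.

(* Main.v *)
(* A discrete Darboux (transfer function) argument shows that C_k is Hermitian
   and unitary, and tr (Lambda_k^* S_k^-1 Lambda_k) = -i tr (alpha - alpha^* )
   does not depend on k.  Hence the squared Frobenius norm of C_k - j equals
   2 (m1 + m2) - 2 tr (C_k j) = u_k - u_(k+1), where
   u_k = 2 tr (Lambda_k^* S_k^-1 Lambda_k (1 - j)) >= 0.  So u_k is nonincreasing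
   and bounded below, it converges, and C_k - j tends to 0. *)
Require Import Defs.
From mathcomp Require Import all_boot all_order all_algebra.
From mathcomp Require Import all_classical all_reals all_analysis.
From mathcomp Require Import complex.
From mathcomp Require Import ring.

Set Implicit Arguments.
Unset Strict Implicit.
Unset Printing Implicit Defensive.

Import Order.TTheory GRing.Theory Num.Theory.
Import numFieldNormedType.Exports.

Local Open Scope classical_set_scope.
Local Open Scope ring_scope.
Local Open Scope sesquilinear_scope.

(** * Conjugate transposes and Frobenius norms *)

Section Adjoint.
Context {C : numClosedFieldType}.

Lemma adjmxM m n p (A : 'M[C]_(m, n)) (B : 'M[C]_(n, p)) :
  (A *m B) ^t* = B ^t* *m A ^t*.
Proof. by rewrite trmx_mul map_mxM. Qed.

Lemma adjmxD m n (A B : 'M[C]_(m, n)) : (A + B) ^t* = A ^t* + B ^t*.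
Proof. by rewrite linearD map_mxD. Qed.

Lemma adjmxN m n (A : 'M[C]_(m, n)) : (- A) ^t* = - A ^t*.
Proof. by rewrite linearN map_mxN. Qed.

Lemma adjmxZ m n c (A : 'M[C]_(m, n)) : (c *: A) ^t* = c^* *: A ^t*.
Proof. by rewrite linearZ map_mxZ. Qed.

Lemma adjmx1 n : (1%:M : 'M[C]_n) ^t* = 1%:M.
Proof. by rewrite trmx1 map_mx1. Qed.

Lemma adjmx_inv n (A : 'M[C]_n) : (invmx A) ^t* = invmx (A ^t*).
Proof. by rewrite trmx_inv map_invmx. Qed.

Lemma adjmx_unit n (A : 'M[C]_n) : (A ^t* \in unitmx) = (A \in unitmx).
Proof. by rewrite map_unitmx unitmx_tr. Qed.

Lemma mulmx_adj_trace m n (A : 'M[C]_(m, n)) :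
  \tr (A *m A ^t*) = \sum_i \sum_k `|A i k| ^+ 2.
Proof.
rewrite /mxtrace; apply: eq_bigr => i _; rewrite !mxE.
by apply: eq_bigr => k _; rewrite !mxE normCK.
Qed.

Lemma mulmx_adj_diag_ge0 m n (A : 'M[C]_(m, n)) i : 0 <= (A *m A ^t*) i i.
Proof.
rewrite !mxE; apply: sumr_ge0 => k _; rewrite !mxE -normCK.
by rewrite exprn_ge0.
Qed.

(** Both squares contribute the trace of the identity, and the two cross terms have equal traces by
    cyclicity. *)
Lemma involutive_dist_trace n (U V : 'M[C]_n) :
  U ^t* = U -> U *m U ^t* = 1%:M -> V ^t* = V -> V *m V = 1%:M ->
  \tr ((U - V) *m (U - V) ^t*) = 2 * \tr (1%:M : 'M[C]_n) - 2 * \tr (U *m V).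
Proof.
move=> Uh UU Vh VV; rewrite adjmxD adjmxN mulmxDl !mulmxDr !mulNmx !mulmxN.
by rewrite Vh UU VV Uh !(mxtraceD, raddfN (@mxtrace C n)) /= (mxtrace_mulC V); ring.
Qed.

End Adjoint.

Definition adjmxE := (@adjmxM, @adjmxD, @adjmxN, @adjmxZ, @adjmx1, @trmxCK).

(* Matrix identities are proved by distributing into monomials, then entry by
   entry with [ring], each matrix product being an atom; [mxE] would unfold
   the products into sums. *)
Section EntryExpansion.
Context {R : comPzRingType} {m n : nat}.
Implicit Types A B : 'M[R]_(m, n).

Lemma addmxij A B i k : (A + B) i k = A i k + B i k.
Proof. by rewrite mxE. Qed.
Lemma oppmxij A i k : (- A) i k = - A i k.
Proof. by rewrite mxE. Qed.
Lemma scalemxij c A i k : (c *: A) i k = c * A i k.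
Proof. by rewrite mxE. Qed.

End EntryExpansion.

Definition mxijE := (@addmxij, @oppmxij, @scalemxij).

Ltac mxexpand := repeat (progress (
  rewrite ?(mulmxDl, mulmxDr, mulmxN, mulNmx, mul1mx, mulmx1, scalerDr, scalerN,
    mulmxA, scalerA) -?scalemxAl -?scalemxAr)).

(** * Positive definite forms *)

Section PositiveForm.
Context {C : numClosedFieldType}.

(** Unlike a condition on eigenvalues, this form of positivity passes directly through congruences
    and sums. *)
Definition posform n (S : 'M[C]_n) : Prop :=
  forall v : 'rV[C]_n, v != 0 -> 0 < (v *m S *m v ^t*) 0 0.

Lemma posform_unit n (S : 'M[C]_n) : posform S -> S \in unitmx.
Proof.
move=> pS; rewrite -row_free_unit; apply: contraT => nfree.
have /rowV0Pn[v /sub_kermxP vS /pS] : kermx S != 0 by rewrite kermx_eq0.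
by rewrite vS mul0mx mxE ltxx.
Qed.

Lemma posform_ge0 n (S : 'M[C]_n) (v : 'rV_n) :
  posform S -> 0 <= (v *m S *m v ^t*) 0 0.
Proof.
move=> pS; have [->|/pS/ltW//] := eqVneq v 0.
by rewrite mul0mx mul0mx mxE.
Qed.

Lemma posform_trace_ge0 n p (S : 'M[C]_n) (Y : 'M[C]_(p, n)) :
  posform S -> 0 <= \tr (Y *m S *m Y ^t*).
Proof.
move=> pS; rewrite /mxtrace; apply: sumr_ge0 => i _.
suff -> : (Y *m S *m Y ^t*) i i = (row i Y *m S *m (row i Y) ^t*) 0 0.
  exact: posform_ge0.
by rewrite -row_mul !mxE; apply: eq_bigr => k _; rewrite !mxE.
Qed.

(** An invertible [B] sends nonzero vectors to nonzero vectors, and the Gram term is nonnegative. *)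
Lemma posform_congruence n p (S B : 'M[C]_n) (Y : 'M[C]_(n, p)) :
  posform S -> B \in unitmx -> posform (B *m S *m B ^t* + Y *m Y ^t*).
Proof.
move=> pS uB v v0; rewrite mulmxDr mulmxDl mxE.
have vB0 : v *m B != 0.
  by apply: contra v0 => /eqP vB; rewrite -(mulmxK uB v) vB mul0mx.
have := pS _ vB0; rewrite adjmxM !mulmxA => h; apply: ltr_wpDr => //.
by have := mulmx_adj_diag_ge0 (v *m Y) 0; rewrite adjmxM !mulmxA.
Qed.

(** By cyclicity this is the trace of [Y S Y^*] with [Y = V^* L^* S^-1], so positivity of [S] itself
    suffices. *)
Lemma gram_trace_ge0 n m p (S : 'M[C]_n) (L : 'M[C]_(n, m)) (V : 'M[C]_(m, p)) :
  S ^t* = S -> posform S ->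
  0 <= \tr (L ^t* *m invmx S *m L *m (V *m V ^t*)).
Proof.
move=> Sh Sp; rewrite mulmxA mxtrace_mulC !mulmxA.
have := posform_trace_ge0 (V ^t* *m L ^t* *m invmx S) Sp.
by rewrite !adjmxE adjmx_inv Sh (mulmxKV (posform_unit Sp)) !mulmxA.
Qed.

(** In a unitary eigenbasis the form is a sum of squared moduli weighted by the eigenvalues. *)
Lemma hermsymmx_posform n (S : 'M[C]_n) : S \is hermsymmx ->
  (forall x, eigenvalue S x -> 0 < x) -> posform S.
Proof.
move=> Sherm Spos.
have /orthomx_spectralP := hermitian_normalmx Sherm.
have Puni := spectral_unitarymx S; have Punit := unitarymx_unit Puni.
move: (spectralmx S) (spectral_diag S) Puni Punit => P d Puni Punit SE.
have dpos k : 0 < d 0 k.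
  apply: Spos; apply/eigenvalueP; exists (row k P).
    rewrite {1}SE -row_mul !mulmxA mulmxV // mul1mx.
    by apply/rowP => q; rewrite mul_diag_mx !mxE.
  apply/negP => /eqP Pk; have := unitarymxP Puni => /row_matrixP/(_ k).
  rewrite row_mul Pk mul0mx row1 => /rowP/(_ k).
  by rewrite !mxE !eqxx => /eqP; rewrite eq_sym oner_eq0.
move=> v v0; rewrite SE; set w := v *m invmx P.
have wE : v ^t* = P ^t* *m w ^t*.
  by rewrite /w -adjmxM mulmxKV.
have w0 : w != 0.
  by apply: contra v0 => /eqP w0; rewrite -(mulmxKV Punit v) -/w w0 mul0mx.
rewrite wE !mulmxA -/w mulmxtVK // mul_mx_diag; clearbody w; rewrite !mxE.
have [k wk] : exists k, w 0 k != 0 by exact/rV0Pn.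
rewrite (bigD1 k) //= ltr_pwDl //.
  by rewrite !mxE mulrAC -normCK mulr_gt0 // exprn_gt0 // normr_gt0.
apply: sumr_ge0 => q _.
by rewrite !mxE mulrAC -normCK mulr_ge0 ?exprn_ge0 // ltW.
Qed.

End PositiveForm.

(** * Consequences of the Lyapunov identity for a single state *)

Section State.
Context {C : numClosedFieldType}.
Variables (n m : nat) (alpha S : 'M[C]_n) (L : 'M[C]_(n, m)).
Local Notation a := (invmx alpha).
Local Notation X := (invmx S).

Hypothesis alpha_unit : alpha \in unitmx.
Hypothesis S_herm : S ^t* = S.
Hypothesis lyapunov : alpha *m S - S *m alpha ^t* = 'i *: (L *m L ^t*).

Let ii : 'i * 'i = -1 :> C.
Proof. by rewrite -expr2 sqrCi. Qed.

Lemma lyapunov_inv : a *m L *m L ^t* *m a ^t* = 'i *: (a *m S - S *m a ^t*).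
Proof.
have /(congr1 (fun X => - 'i *: (a *m X *m a ^t*))) := lyapunov.
mxexpand; rewrite mulVmx // mul1mx adjmx_inv mulmxK ?adjmx_unit // => E.
apply/matrixP => p q; move: E => /matrixP/(_ p q); rewrite !mxijE.
by rewrite (mulNr 'i 'i) ii opprK mul1r => <-; ring.
Qed.

Hypothesis S_unit : S \in unitmx.

(* The value at zero of the transfer function
   [w(z) = 1 - i L^* S^-1 (alpha - z)^-1 L]; its unitarity and the relation
   [w'(0) j = C w(0)] below are what makes [C] unitary. *)
Definition transfer0 := 1%:M - 'i *: (L ^t* *m X *m a *m L).

Lemma transfer0_unitary : transfer0 *m transfer0 ^t* = 1%:M.
Proof.
rewrite /transfer0 !adjmxE conjCi (adjmx_inv S) S_herm; mxexpand.
have -> : L ^t* *m X *m a *m L *m L ^t* *m a ^t* *m X *m L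
  = L ^t* *m X *m (a *m L *m L ^t* *m a ^t*) *m X *m L by rewrite !mulmxA.
rewrite lyapunov_inv; mxexpand; rewrite mulmxK // mulmxKV //.
by apply/matrixP => p q; rewrite !mxijE; ring: ii.
Qed.

(** The right-hand side involves [alpha] only, which makes this trace an invariant of the
    recursion. *)
Lemma trace_gram : \tr (L ^t* *m X *m L) = - 'i * (\tr alpha - \tr (alpha ^t*)).
Proof.
rewrite mxtrace_mulC mulmxA.
have -> : L *m L ^t* = - 'i *: (alpha *m S - S *m alpha ^t*).
  by rewrite lyapunov scalerA mulNr ii opprK scale1r.
rewrite -scalemxAl linearZ /= mulmxDl mulNmx mulmxK // linearD linearN /=.
by rewrite -mulmxA mxtrace_mulC -mulmxA mulVmx // mulmx1.
Qed.

End State.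

(** * One step of the recursion *)

Section Step.
Context {C : numClosedFieldType}.
Variables (n m : nat) (alpha S : 'M[C]_n) (L : 'M[C]_(n, m)) (j : 'M[C]_m).
Local Notation a := (invmx alpha).
Variables (L' : 'M[C]_(n, m)) (S' : 'M[C]_n).

Hypothesis L'E : L' = L + 'i *: (a *m L *m j).
Hypothesis S'def : S' = S + a *m S *m invmx (alpha ^t*)
                          + a *m L *m j *m L ^t* *m invmx (alpha ^t*).
Hypothesis alpha_unit : alpha \in unitmx.
Hypothesis j_herm : j ^t* = j.
Hypothesis j_invol : j *m j = 1%:M.
Hypothesis S_herm : S ^t* = S.
Hypothesis lyapunov : alpha *m S - S *m alpha ^t* = 'i *: (L *m L ^t*).

Let ii : 'i * 'i = -1 :> C.
Proof. by rewrite -expr2 sqrCi. Qed.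

Let L'adj : L' ^t* = L ^t* - 'i *: (j *m L ^t* *m a ^t*).
Proof. by rewrite L'E !adjmxE conjCi scaleNr j_herm mulmxA. Qed.

Let S'E : S' = S + a *m S *m a ^t* + a *m L *m j *m L ^t* *m a ^t*.
Proof. by rewrite S'def -adjmx_inv. Qed.

Let alphaK p (A : 'M[C]_(p, n)) : A *m alpha *m a = A.
Proof. exact: mulmxK. Qed.
Let aadjK p (A : 'M[C]_(p, n)) : A *m a ^t* *m alpha ^t* = A.
Proof. by rewrite adjmx_inv mulmxKV ?adjmx_unit. Qed.
Let alphaV : alpha *m a = 1%:M. Proof. exact: mulmxV. Qed.
Let aalpha : a *m alpha = 1%:M. Proof. exact: mulVmx. Qed.

Lemma step_herm : S' ^t* = S'.
Proof. by rewrite S'E !adjmxE S_herm j_herm !mulmxA. Qed.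

(** After [j *m j] is simplified, the terms in [j] agree on both sides; the old identity and its
    conjugate [lyapunov_inv] match the others. *)
Lemma step_lyapunov : alpha *m S' - S' *m alpha ^t* = 'i *: (L' *m L' ^t*).
Proof.
rewrite S'E L'adj L'E; mxexpand.
rewrite !aadjK alphaV !mul1mx -(mulmxA _ j j) j_invol mulmx1.
rewrite (lyapunov_inv alpha_unit lyapunov).
have -> : alpha *m S = S *m alpha ^t* + 'i *: (L *m L ^t*).
  by rewrite -lyapunov addrC subrK.
by apply/matrixP => p q; rewrite !mxijE; ring: ii.
Qed.

(* The backward Cayley factor turns the recursion for [S] into a positive
   perturbation of a congruence. *)
Lemma step_congruence : S' =
  (1%:M - 'i *: a) *m S *m (1%:M - 'i *: a) ^t*
  + a *m L *m (1%:M + j) *m (a *m L) ^t*.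
Proof.
rewrite S'E !adjmxE conjCi; mxexpand; rewrite (lyapunov_inv alpha_unit lyapunov).
by apply/matrixP => p q; rewrite !mxijE; ring: ii.
Qed.

Lemma step_posform : ~~ eigenvalue alpha 'i -> posform S -> posform S'.
Proof.
move=> hi pS; have uB : 1%:M - 'i *: a \in unitmx.
  have -> : 1%:M - 'i *: a = a *m (alpha - 'i%:M).
    by rewrite mulmxDr mulmxN aalpha mul_mx_scalar.
  rewrite unitmx_mul unitmx_inv alpha_unit /= -row_free_unit -kermx_eq0.
  by apply: contraR hi.
(* Since [(1 + j)^2 = 2 (1 + j)], scaling [1 + j] by the square root of 1/2 gives a factor [Z] with
   [Z Z^* = 1 + j]. *)
set c : C := sqrtC 2^-1.
have cc : c * c^* = 2^-1.
  by rewrite geC0_conj ?sqrtC_ge0 ?invr_ge0 ?ler0n // -expr2 sqrtCK.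
have ZZ : (c *: (1%:M + j)) *m (c *: (1%:M + j)) ^t* = 1%:M + j.
  rewrite !adjmxE j_herm -scalemxAl -scalemxAr scalerA cc; mxexpand.
  rewrite j_invol; apply/matrixP => p q; rewrite !mxijE.
  by field.
move: ZZ step_congruence; set Z := c *: _ => <- ->.
rewrite [X in _ + X](_ : _ = (a *m L *m Z) *m (a *m L *m Z) ^t*).
  exact: posform_congruence.
by rewrite !adjmxM !mulmxA.
Qed.

Section Inverse.
Hypothesis S_unit : S \in unitmx.
Hypothesis S'_unit : S' \in unitmx.
Local Notation X := (invmx S).
Local Notation X' := (invmx S').

Let SX p (A : 'M[C]_(p, n)) : A *m S *m X = A. Proof. exact: mulmxK. Qed.
Let XS p (A : 'M[C]_(p, n)) : A *m X *m S = A. Proof. exact: mulmxKV. Qed.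
Let X'S' p (A : 'M[C]_(p, n)) : A *m X' *m S' = A. Proof. exact: mulmxKV. Qed.

(** This mixed identity couples consecutive states; multiplied by both inverses, it makes the
    product [X' L' L^* X] linear in [X] and [X']. *)
Lemma step_sylvester : S' *m alpha ^t* + 'i *: (L' *m L ^t*) = (alpha + a) *m S.
Proof.
rewrite S'E L'E; mxexpand; rewrite !aadjK.
have -> : alpha *m S = S *m alpha ^t* + 'i *: (L *m L ^t*).
  by rewrite -lyapunov addrC subrK.
by apply/matrixP => p q; rewrite !mxijE; ring: ii.
Qed.

Let w := transfer0 alpha S L.
Let w' := transfer0 alpha S' L'.

(** The terms quadratic in the inverses are eliminated by the Sylvester identity ([L'Y]) and the
    Lyapunov identity ([LY]); the linear remainder cancels. *)
Lemma transfer0_step :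
  w' *m j = (j + L ^t* *m X *m L - L' ^t* *m X' *m L') *m w.
Proof.
have L'Y p (Y : 'M[C]_(n, p)) : 'i *: (L' ^t* *m X' *m L' *m L ^t* *m X *m Y)
   = L' ^t* *m X' *m (alpha + a) *m Y - L' ^t* *m alpha ^t* *m X *m Y.
  have /(congr1 (fun Z => L' ^t* *m X' *m Z *m X *m Y)) := step_sylvester.
  by mxexpand; rewrite X'S' !SX => <-; rewrite addrC addKr.
have LY : 'i *: (L ^t* *m X *m L *m L ^t* *m X *m a *m L) =
   L ^t* *m X *m L - L ^t* *m alpha ^t* *m X *m a *m L.
  have /(congr1 (fun Z => L ^t* *m X *m Z *m X *m a *m L)) := lyapunov.
  by mxexpand; rewrite SX alphaK XS => <-.
rewrite /w /w' /transfer0; mxexpand.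
have := L'Y _ (a *m L); rewrite !mulmxA => ->; rewrite LY.
have -> : L' ^t* *m alpha ^t* = L ^t* *m alpha ^t* - 'i *: (j *m L ^t*).
  by rewrite L'adj; mxexpand; rewrite aadjK.
(* Folding [V] shields the left factor, so that only the right factor [L'] is expanded. *)
set V := L' ^t* *m X'; rewrite L'E; mxexpand.
rewrite alphaK -(mulmxA _ j j) j_invol mulmx1.
by apply/matrixP => p q; rewrite !mxijE; ring: ii.
Qed.

Let D := j + L ^t* *m X *m L - L' ^t* *m X' *m L'.

Let D_herm : D ^t* = D.
Proof.
rewrite /D !adjmxE !adjmx_inv S_herm j_herm step_herm //.
by rewrite !mulmxA.
Qed.

(** As [w] is unitary, [transfer0_step] can be solved for [D = w' j w^*], a product of unitary
    matrices. *)
Let D_invol : D *m D ^t* = 1%:M.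
Proof.
have ww : w *m w ^t* = 1%:M by apply: transfer0_unitary.
have w'w' : w' *m w' ^t* = 1%:M.
  by apply: transfer0_unitary => //; [exact: step_herm | exact: step_lyapunov].
have -> : D = w' *m j *m w ^t* by rewrite transfer0_step -(mulmxA _ w) ww mulmx1.
rewrite 2!adjmxM trmxCK j_herm !mulmxA -(mulmxA _ (w ^t*) w) (mulmx1C ww) mulmx1.
by rewrite -(mulmxA _ j j) j_invol mulmx1.
Qed.

(** The weight [2 (1 - j)] is written as a Gram matrix so that [gram_trace_ge0] applies to each
    term; its constant part drops out by [trace_gram]. *)
Lemma step_sqr_norm :
  \sum_p \sum_q `|(j + L ^t* *m X *m L - L' ^t* *m X' *m L' - j) p q| ^+ 2 =
  \tr (L ^t* *m X *m L *m ((1%:M - j) *m (1%:M - j) ^t*)) -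
  \tr (L' ^t* *m X' *m L' *m ((1%:M - j) *m (1%:M - j) ^t*)).
Proof.
have jj : (1%:M - j) *m (1%:M - j) ^t* = 2 *: 1%:M - 2 *: j.
  rewrite !adjmxE j_herm; mxexpand; rewrite j_invol.
  by apply/matrixP => p q; rewrite !mxijE; ring.
have trW : \tr (L ^t* *m X *m L) = \tr (L' ^t* *m X' *m L').
  by rewrite (@trace_gram _ _ _ alpha) // (@trace_gram _ _ _ alpha) // step_lyapunov.
rewrite -mulmx_adj_trace (involutive_dist_trace D_herm D_invol) // jj.
rewrite /D; mxexpand; rewrite j_invol.
by rewrite !(mxtraceD, mxtraceZ, raddfN (@mxtrace C m)) /= !mxtraceZ trW; ring.
Qed.

End Inverse.
End Step.

(** * Convergence from a telescoping bound *)

Section Convergence.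
Variable R : realType.

(** Nonnegative elements of [R[i]] are real, so monotone convergence applies to the real parts; a
    sequence and its shift have the same limit. *)
Lemma telescoping_ge0_cvg0 (u : nat -> R[i]) :
  (forall k, 0 <= u k) -> (forall k, u k.+1 <= u k) ->
  forall e : R[i], 0 < e -> \forall k \near \oo, u k - u k.+1 < e.
Proof.
move=> u0 ud e e0.
have uR k : u k = (complex.Re (u k))%:C%C.
  by rewrite RRe_real // ger0_real.
have eR : e = (complex.Re e)%:C%C by rewrite RRe_real // gtr0_real.
set r := fun k => complex.Re (u k).
have rd : nonincreasing_seq r.
  apply/nonincreasing_seqP => k; have := ud k.
  by rewrite (uR k) (uR k.+1) lecR.
have rc : cvgn r.
  apply: nonincreasing_is_cvgn => //; exists 0 => _ [k _ <-].
  by have := u0 k; rewrite (uR k) ler0c.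
have r0 : (fun k => r k - r k.+1) @ \oo --> (0 : R).
  rewrite -(subrr (lim (r @ \oo))); apply: cvgB => //.
  by rewrite (cvg_shiftS r).
have e0' : 0 < complex.Re e by move: e0; rewrite {1}eR ltcR.
have /cvgrPdist_lt/(_ _ e0') := r0.
apply: filterS => k; rewrite sub0r normrN => h.
rewrite (uR k) (uR k.+1) eR -rmorphB /= ltcR.
exact: le_lt_trans (ler_norm _) h.
Qed.

Lemma cvg_mx_sqr_norm p q (F : nat -> 'M[R[i]]_(p, q)) (G : 'M[R[i]]_(p, q))
    (u : nat -> R[i]) :
  (forall k, 0 <= u k) ->
  (forall k, \sum_s \sum_t `|(F k - G) s t| ^+ 2 = u k - u k.+1) ->
  F k @[k --> \oo] --> G.
Proof.
move=> u0 FG.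
have ud k : u k.+1 <= u k.
  rewrite -subr_ge0 -FG; apply: sumr_ge0 => s _; apply: sumr_ge0 => t _.
  exact: exprn_ge0.
(* Matrix balls are entrywise, and the square of each entry is at most the whole sum; hence the
   radius [e ^+ 2]. *)
apply/cvg_ballP => e e0; have e20 : 0 < e ^+ 2 by rewrite exprn_gt0.
have := telescoping_ge0_cvg0 u0 ud e20.
apply: filterS => k; rewrite -FG => h; split => // s t.
rewrite -ball_normE /ball_ /= distrC.
rewrite -(@ltr_pXn2r _ 2) ?nnegrE ?normr_ge0 ?(ltW e0) //.
apply: le_lt_trans h.
rewrite (bigD1 s) //= (bigD1 t) //= !mxE -addrA lerDl addr_ge0 //.
  by apply: sumr_ge0 => ? _; exact: exprn_ge0.
by apply: sumr_ge0 => ? _; apply: sumr_ge0 => ? _; exact: exprn_ge0.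
Qed.

End Convergence.

(** * The signature matrix and the limit of the sequence *)

Lemma signature_mx_herm (R : realType) m1 m2 :
  (signature_mx R m1 m2) ^t* = signature_mx R m1 m2.
Proof.
rewrite /signature_mx tr_block_mx map_block_mx !trmx0 !map_mx0.
by rewrite adjmx1 adjmxN adjmx1.
Qed.

Lemma signature_mx_invol (R : realType) m1 m2 :
  signature_mx R m1 m2 *m signature_mx R m1 m2 = 1%:M.
Proof.
rewrite /signature_mx mulmx_block !mul0mx !mulmx0 mulNmx mulmxN opprK !mul1mx.
by rewrite !addr0 !add0r -scalar_mx_block.
Qed.

Local Open Scope complex_scope.

Theorem corollary4p11 (R : realType) (n m1 m2 : nat)
    (alpha S0 : 'M[R[i]]_n)
    (theta1 : 'M[R[i]]_(n, m1)) (theta2 : 'M[R[i]]_(n, m2))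
    (hadm : admissible alpha S0 theta1 theta2)
    (h0 : ~~ eigenvalue alpha 0) (hi : ~~ eigenvalue alpha 'i) :
  C_seq alpha S0 theta1 theta2 k @[k --> \oo] --> signature_mx R m1 m2.
Proof.
have [[S0_herm S0_pos] lyap0] := hadm.
have alpha_unit : alpha \in unitmx.
  rewrite -row_free_unit -kermx_eq0; apply: contraR h0.
  by rewrite /eigenvalue /eigenspace raddf0 subr0.
set j := signature_mx R m1 m2.
have j_herm : j ^t* = j by exact: signature_mx_herm.
have j_invol : j *m j = 1%:M by exact: signature_mx_invol.
pose S := S_seq alpha S0 theta1 theta2; pose L := Lambda_seq alpha theta1 theta2.
have LE k : L k.+1 = L k + 'i%R *: (invmx alpha *m L k *m j) by [].
have SE k : S k.+1 = S k + invmx alpha *m S k *m invmx (alpha ^t*)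
    + invmx alpha *m L k *m j *m (L k) ^t* *m invmx (alpha ^t*) by [].
(* The three properties are carried together because positivity at the next step uses the Lyapunov
   identity at the current one. *)
have inv k : [/\ (S k) ^t* = S k, posform (S k) &
    alpha *m S k - S k *m alpha ^t* = 'i *: (L k *m (L k) ^t*)].
  elim: k => [|k [Sh Sp lyap]].
    split; [|exact: hermsymmx_posform|].
      by move/is_hermitianmxP: S0_herm; rewrite expr0 scale1r.
    by rewrite lyap0 /L /= tr_row_mx map_col_mx mul_row_col.
  split; [exact: step_herm (SE k) j_herm Sh | |].
    exact: (step_posform (SE k) alpha_unit j_herm j_invol lyap hi Sp).
  exact: step_lyapunov (LE k) (SE k) alpha_unit j_herm j_invol lyap.
pose u k := \tr ((L k) ^t* *m invmx (S k) *m L k *m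
  ((1%:M - j) *m (1%:M - j) ^t*)).
apply: (@cvg_mx_sqr_norm _ _ _ _ _ u) => k.
  by have [Sh Sp _] := inv k; exact: gram_trace_ge0.
have [Sh /posform_unit Su lyap] := inv k.
have [_ /posform_unit Su' _] := inv k.+1.
exact: (step_sqr_norm (LE k) (SE k) alpha_unit j_herm j_invol Sh lyap Su Su').
Qed.
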